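(* Let $\mathcal M=\langle W_{\mathcal M},\le_{\mathcal M},\mathcal D_{\mathcal M},\mathcal I_{\mathcal M}\rangle$ be a structure (persistent first-order intuitionistic Kripke $\omega$-structure) with $\mathcal J^{\mathcal M}_{\mathrm{ff}}(\mathcal I_{\mathcal M})=\mathcal I_{\mathcal M}$. Then $$\bigcap_{w\in W_{\mathcal M}}\mathcal I_{\mathcal M}(w)=\mathcal J^{\mathcal M}_{\mathrm{svi}}\Big(\bigcap_{w\in W_{\mathcal M}}\mathcal I_{\mathcal M}(w)\Big).$$
   Context: **Language.** $\mathcal L_{\mathbb N}$ is the language of Heyting arithmetic (logical symbols $\bot,\to,\vee,\wedge,\forall,\exists$; $\neg A$ is $A\to\bot$), with finitely many additional function symbols for primitive recursive functions. $\mathcal L_{\mathrm{Tr}}=\mathcal L_{\mathbb N}\cup\{\mathrm{Tr}\}$ with $\mathrm{Tr}$ a unary predicate. Fix a standard Gödel numbering; $\#\varphi$ is the code of $\varphi$, $\bar n$ the numeral of $n$, $t^{\mathbb N}$ the value of a closed term $t$ in the standard model. $\mathrm{SENT}\subseteq\omega$ is the set of codes of sentences of $\mathcal L_{\mathrm{Tr}}$. **Structures.** A *structure* is $\mathcal M=\langle W_{\mathcal M},\le_{\mathcal M},\mathcal D_{\mathcal M},\mathcal I_{\mathcal M}\rangle$ with $W_{\mathcal M}$ a set (of worlds), $\le_{\mathcal M}$ a partial order on it, $\mathcal D_{\mathcal M}$ assigning the domain $\omega$ to each world, and $\mathcal I_{\mathcal M}\subseteq W_{\mathcal M}\times\mathrm{SENT}$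 *persistent*: $u\le_{\mathcal M}v$ and $\langle u,x\rangle\in\mathcal I_{\mathcal M}$ imply $\langle v,x\rangle\in\mathcal I_{\mathcal M}$. Write $\mathcal I_{\mathcal M}(w)=\{x:\langle w,x\rangle\in\mathcal I_{\mathcal M}\}$. **Forcing** $w\Vdash_{\mathcal M}A$ (also written $w,\mathcal I_{\mathcal M}\Vdash A$ when the frame $\langle W_{\mathcal M},\le_{\mathcal M},\mathcal D_{\mathcal M}\rangle$ is fixed), for sentences $A$: $w\nVdash\bot$; an atomic arithmetical sentence is forced iff true in $\mathbb N$; $w\Vdash\mathrm{Tr}(s)$ iff $s^{\mathbb N}\in\mathcal I_{\mathcal M}(w)$; $\wedge,\vee$ are evaluated at $w$ in the usual way; $w\Vdash A\to B$ iff for all $w'\ge w$, $w'\Vdash A$ implies $w'\Vdash B$; $w\Vdash\exists xA$ iff $w\Vdash A(\bar n)$ for some $n\in\omega$; $w\Vdash\forall xA$ iff $w'\Vdash A(\bar n)$ for all $w'\ge w$, $n\in\omega$. **Fixed-frame scheme.** For persistent $\mathcal I,\mathcal I'\subseteq W_{\mathcal M}\times\mathrm{SENT}$ over the frame of $\mathcal M$, $\mathcal I\preceq\mathcal I'$ means $\mathcal I\subseteq\mathcal I'$. $w,\mathcal I\Vdash_{\mathrm{ff}}\varphi$ iff $w,\mathcal I'\Vdash\varphi$ for all persistent $\mathcal I'\succeq\mathcal I$. $\mathcal J^{\mathcal M}_{\mathrm{ff}}(\mathcal I)$ is the relation on $W_{\mathcal M}\times\mathrm{SENT}$ with $\mathcal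 J^{\mathcal M}_{\mathrm{ff}}(\mathcal I)(w)=\{\#\varphi: w,\mathcal I\Vdash_{\mathrm{ff}}\varphi\}$ for each $w\in W_{\mathcal M}$. **Embeddings.** $f:W_{\mathcal N}\to W_{\mathcal N'}$ is an embedding-interpretation function, written $\mathcal I_{\mathcal N}\leqq_f\mathcal I_{\mathcal N'}$, iff $f$ is injective, $w_0\le_{\mathcal N}w_1\Leftrightarrow f(w_0)\le_{\mathcal N'}f(w_1)$, and $\mathcal I_{\mathcal N}(w)\subseteq\mathcal I_{\mathcal N'}(f(w))$ for all $w$. **The scheme svi relative to $\mathcal M$.** For a structure $\mathcal N$ and $w\in W_{\mathcal N}$, $w,\mathcal I_{\mathcal N}\Vdash^{\mathcal N}_{\mathrm{svi}_{\mathcal M}}\varphi$ iff for every structure $\mathcal N'$, every $f$, and every order isomorphism $\tau:(W_{\mathcal N'},\le_{\mathcal N'})\to(W_{\mathcal M},\le_{\mathcal M})$ such that $\mathcal I_{\mathcal N}\leqq_f\mathcal I_{\mathcal N'}$ and $\mathcal I_{\mathcal N'}(u)\supseteq\mathcal I_{\mathcal M}(\tau(u))$ for all $u\in W_{\mathcal N'}$, one has $f(w)\Vdash_{\mathcal N'}\varphi$. For $X\subseteq\mathrm{SENT}$: $\mathcal J^{\mathcal M}_{\mathrm{svi}}(X)=\{\#\varphi\in\mathrm{SENT}:\forall\mathcal N\,\forall w\in W_{\mathcal N}(\mathcal I_{\mathcal N}(w)=X\Rightarrow w,\mathcal I_{\mathcal N}\Vdash^{\mathcal N}_{\mathrm{svi}_{\mathcal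 M}}\varphi)\}$. *)

(* Defs.v *)
From mathcomp Require Import all_boot.
From mathcomp Require Import classical_sets.
From Stdlib Require Import Relation_Definitions.

Set Implicit Arguments.
Unset Strict Implicit.
Unset Printing Implicit Defensive.

Local Open Scope classical_set_scope.

(* Closure under pointwise equality is a constructor, so that no extensionality
   axiom is needed to recognise a function as primitive recursive. *)
Inductive primitive_recursive : forall n, (n.-tuple nat -> nat) -> Prop :=
| pr_zero : primitive_recursive (fun _ : 0.-tuple nat => 0)
| pr_succ : primitive_recursive (fun v : 1.-tuple nat => (thead v).+1)
| pr_proj n (i : 'I_n) : primitive_recursive (fun v : n.-tuple nat => tnth v i)
| pr_comp m n (g : m.-tuple nat -> nat) (h : 'I_m -> n.-tuple nat -> nat) :
    primitive_recursive g -> (forall i, primitive_recursive (h i)) ->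
    primitive_recursive (fun v => g [tuple h i v | i < m])
| pr_rec n (g : n.-tuple nat -> nat) (h : n.+2.-tuple nat -> nat) :
    primitive_recursive g -> primitive_recursive h ->
    primitive_recursive (fun v : n.+1.-tuple nat =>
      iteri (thead v) (fun k r => h [tuple of k :: r :: behead_tuple v])
            (g (behead_tuple v)))
| pr_ext n (f g : n.-tuple nat -> nat) :
    f =1 g -> primitive_recursive f -> primitive_recursive g.

(* Function symbols added to zero, successor, addition and multiplication. *)
Record signature := Signature {
  symbol : finType;
  arity : symbol -> nat;
  fun_interp : forall f : symbol, (arity f).-tuple nat -> nat;
  fun_interp_pr : forall f : symbol, primitive_recursive (@fun_interp f)
}.

Section Syntax.
Variable L : signature.

Inductive term :=
| Var of nat
| Zero
| Succ of term
| Add of term & term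
| Mul of term & term
| App (f : symbol L) of {ffun 'I_(arity f) -> term}.

Inductive formula :=
| Bot
| Eq of term & term
| Tr of term
| Imp of formula & formula
| Or of formula & formula
| And of formula & formula
| All of nat & formula
| Ex of nat & formula.

Fixpoint numeral (n : nat) : term :=
  if n is n'.+1 then Succ (numeral n') else Zero.

Fixpoint term_fv (t : term) : seq nat :=
  match t with
  | Var x => [:: x]
  | Zero => [::]
  | Succ t1 => term_fv t1
  | Add t1 t2 | Mul t1 t2 => term_fv t1 ++ term_fv t2
  | App f a => flatten [seq term_fv (a i) | i <- enum 'I_(arity f)]
  end.

Fixpoint fv (A : formula) : seq nat :=
  match A with
  | Bot => [::]
  | Eq s t => term_fv s ++ term_fv t
  | Tr s => term_fv s
  | Imp B C | Or B C | And B C => fv B ++ fv C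
  | All x B | Ex x B => [seq y <- fv B | y != x]
  end.

Definition sentence (A : formula) : bool := nilp (fv A).

Fixpoint term_subst (x : nat) (s t : term) : term :=
  match t with
  | Var y => if y == x then s else Var y
  | Zero => Zero
  | Succ t1 => Succ (term_subst x s t1)
  | Add t1 t2 => Add (term_subst x s t1) (term_subst x s t2)
  | Mul t1 t2 => Mul (term_subst x s t1) (term_subst x s t2)
  | App f a => App [ffun i => term_subst x s (a i)]
  end.

(* Bound variables are not renamed: this is correct for closed s, the only
   case used. *)
Fixpoint subst (x : nat) (s : term) (A : formula) : formula :=
  match A with
  | Bot => Bot
  | Eq t1 t2 => Eq (term_subst x s t1) (term_subst x s t2)
  | Tr t => Tr (term_subst x s t)
  | Imp B C => Imp (subst x s B) (subst x s C)
  | Or B C => Or (subst x s B) (subst x s C)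
  | And B C => And (subst x s B) (subst x s C)
  | All y B => All y (if y == x then B else subst x s B)
  | Ex y B => Ex y (if y == x then B else subst x s B)
  end.

(* The value in the standard model; the clause for variables is a dummy, only
   closed terms being evaluated in sentences. *)
Fixpoint value (t : term) : nat :=
  match t with
  | Var _ => 0
  | Zero => 0
  | Succ t1 => (value t1).+1
  | Add t1 t2 => value t1 + value t2
  | Mul t1 t2 => value t1 * value t2
  | App f a => fun_interp [tuple value (a i) | i < arity f]
  end.

Fixpoint depth (A : formula) : nat :=
  match A with
  | Bot | Eq _ _ | Tr _ => 0
  | Imp B C | Or B C | And B C => (maxn (depth B) (depth C)).+1
  | All _ B | Ex _ B => (depth B).+1
  end.

(* Any injective numbering is allowed; the standard ones are instances. *)
Record goedel_numbering := GoedelNumbering {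
  code :> formula -> nat;
  code_inj : injective code
}.

Record frame := Frame {
  world :> Type;
  acc : relation world;
  acc_order : order world acc
}.

(* Forcing for formulas of depth < k. The recursion is on k rather than on the
   formula because A(numeral n) is not a subformula of All x A. *)
Fixpoint forces_upto (k : nat) (W : frame) (I : W -> set nat) (w : W)
    (A : formula) : Prop :=
  if k is k'.+1 then
    match A with
    | Bot => False
    | Eq s t => value s = value t
    | Tr s => I w (value s)
    | Imp B C => forall w', acc w w' ->
                   forces_upto k' I w' B -> forces_upto k' I w' C
    | Or B C => forces_upto k' I w B \/ forces_upto k' I w C
    | And B C => forces_upto k' I w B /\ forces_upto k' I w C
    | All x B => forall w' n, acc w w' ->
                   forces_upto k' I w' (subst x (numeral n) B)
    | Ex x B => exists n, forces_upto k' I w (subst x (numeral n) B)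
    end
  else False.

(* The domain of every world is the set of all natural numbers. *)
Definition forces (W : frame) (I : W -> set nat) (w : W) (A : formula) : Prop :=
  forces_upto (depth A).+1 I w A.

Lemma depth_subst x s A : depth (subst x s A) = depth A.
Proof.
elim: A => //= [B -> C ->|B -> C ->|B -> C ->|y B IH|y B IH] //;
  by case: eqP => // _; rewrite IH.
Qed.

Lemma forces_uptoE k (W : frame) (I : W -> set nat) w A :
  depth A < k -> forces_upto k I w A <-> forces I w A.
Proof.
suff H j : depth A < j -> depth A < k ->
    forces_upto j I w A <-> forces_upto k I w A.
  by move=> Ak; apply: iff_sym; apply: H.
elim: j k w A => [//|j IH] [//|k] w A.
case: A => //= [B C|B C|B C|x B|x B]; rewrite !ltnS ?gtn_max.
- move=> /andP[Bj Cj] /andP[Bk Ck].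
  have HB w' := IH k w' B Bj Bk; have HC w' := IH k w' C Cj Ck.
  by split=> H w' ww' /HB FB; apply/HC/H.
- move=> /andP[Bj Cj] /andP[Bk Ck].
  by rewrite (IH k w B Bj Bk) (IH k w C Cj Ck).
- move=> /andP[Bj Cj] /andP[Bk Ck].
  by rewrite (IH k w B Bj Bk) (IH k w C Cj Ck).
- move=> Bj Bk.
  have HB w' n : forces_upto j I w' (subst x (numeral n) B) <->
                 forces_upto k I w' (subst x (numeral n) B).
    by apply: IH; rewrite depth_subst.
  by split=> H w' n /(H w' n)/HB.
- move=> Bj Bk.
  have HB n : forces_upto j I w (subst x (numeral n) B) <->
              forces_upto k I w (subst x (numeral n) B).
    by apply: IH; rewrite depth_subst.
  by split=> -[n /HB H]; exists n.
Qed.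

Section ForcingClauses.
Variables (W : frame) (I : W -> set nat).

Lemma forces_Bot w : forces I w Bot <-> False.
Proof. by []. Qed.

Lemma forces_Eq w s t : forces I w (Eq s t) <-> value s = value t.
Proof. by []. Qed.

Lemma forces_Tr w s : forces I w (Tr s) <-> value s \in I w.
Proof. by rewrite inE. Qed.

Lemma forces_Imp w B C :
  forces I w (Imp B C) <->
  forall w', acc w w' -> forces I w' B -> forces I w' C.
Proof.
have HB w' : forces_upto (maxn (depth B) (depth C)).+1 I w' B <-> forces I w' B.
  by apply: forces_uptoE; rewrite ltnS leq_maxl.
have HC w' : forces_upto (maxn (depth B) (depth C)).+1 I w' C <-> forces I w' C.
  by apply: forces_uptoE; rewrite ltnS leq_maxr.
by split=> H w' ww' /HB FB; apply/HC/H.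
Qed.

Lemma forces_Or w B C :
  forces I w (Or B C) <-> forces I w B \/ forces I w C.
Proof.
rewrite -(@forces_uptoE (maxn (depth B) (depth C)).+1 W I w B) ?ltnS ?leq_maxl //.
by rewrite -(@forces_uptoE (maxn (depth B) (depth C)).+1 W I w C) ?ltnS ?leq_maxr.
Qed.

Lemma forces_And w B C :
  forces I w (And B C) <-> forces I w B /\ forces I w C.
Proof.
rewrite -(@forces_uptoE (maxn (depth B) (depth C)).+1 W I w B) ?ltnS ?leq_maxl //.
by rewrite -(@forces_uptoE (maxn (depth B) (depth C)).+1 W I w C) ?ltnS ?leq_maxr.
Qed.

Lemma forces_All w x B :
  forces I w (All x B) <->
  forall w' n, acc w w' -> forces I w' (subst x (numeral n) B).
Proof. by split=> H w' n /(H w' n); rewrite /forces /= depth_subst. Qed.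

Lemma forces_Ex w x B :
  forces I w (Ex x B) <-> exists n, forces I w (subst x (numeral n) B).
Proof. by split=> -[n H]; exists n; move: H; rewrite /forces /= depth_subst. Qed.

End ForcingClauses.

Variable G : goedel_numbering.

Definition SENT : set nat := [set G A | A in [set A | sentence A]].

(* A relation between worlds and codes of sentences, given by its sections. *)
Definition persistent (W : frame) (I : W -> set nat) : Prop :=
  (forall w, I w `<=` SENT) /\ (forall u v, acc u v -> I u `<=` I v).

Record structure := Structure {
  frame_of :> frame;
  interp : frame_of -> set nat;
  interp_persistent : persistent interp
}.

Definition forces_ff (W : frame) (I : W -> set nat) (w : W) (A : formula) :=
  forall I' : W -> set nat,
    persistent I' -> (forall u, I u `<=` I' u) -> forces I' w A.

Definition J_ff (W : frame) (I : W -> set nat) : W -> set nat :=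
  fun w => [set G A | A in [set A | sentence A /\ forces_ff I w A]].

Definition embedding_interp (N N' : structure) (f : N -> N') : Prop :=
  [/\ injective f,
      forall u v, acc u v <-> acc (f u) (f v) &
      forall w, interp w `<=` interp (f w)].

Definition order_isomorphism (V W : frame) (tau : V -> W) : Prop :=
  bijective tau /\ forall u v, acc u v <-> acc (tau u) (tau v).

Definition forces_svi (M N : structure) (w : N) (A : formula) : Prop :=
  forall (N' : structure) (f : N -> N') (tau : N' -> M),
    order_isomorphism tau -> embedding_interp f ->
    (forall u, interp (tau u) `<=` interp u) ->
    forces (@interp N') (f w) A.

Definition J_svi (M : structure) (X : set nat) : set nat :=
  [set G A | A in [set A | sentence A /\
     forall (N : structure) (w : N), interp w = X -> forces_svi M w A]].

End Syntax.

(* Main.v *)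
(* Inclusion from left to right: an order isomorphism onto the frame of M turns
   every structure admitted by svi relative to M into a persistent extension of
   the interpretation of M, and forcing is invariant under isomorphism.
   Conversely, a persistent extension of the interpretation of M receives an
   embedding of the one-world structure interpreted by the intersection, sending
   its world to any given world of M; so svi applied to that structure yields
   ff-forcing at every world. *)
Require Import Defs.
From mathcomp Require Import all_boot.
From mathcomp Require Import classical_sets.
From Stdlib Require Import Relation_Definitions.
Local Open Scope classical_set_scope.

(** The back condition lifts each world above [h u] to one above [u], as [Imp] and [All] require.
    Induction is on the bound [k], since instances of a quantified formula are not subformulas. *)
Lemma forces_bounded_morphism (L : signature) (V W : frame)
    (I : V -> set nat) (J : W -> set nat) (h : V -> W) :
  (forall u v, acc u v -> acc (h u) (h v)) ->
  (forall u w, acc (h u) w -> exists2 v, acc u v & h v = w) ->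
  (forall u, I u = J (h u)) ->
  forall u (A : formula L), forces I u A <-> forces J (h u) A.
Proof.
move=> hacc hback IJ u A; rewrite /forces.
move: (depth A).+1 => k; elim: k u A => [//|k IH] u [|s t|s|B C|B C|B C|x B|x B] //=.
- by rewrite IJ.
- split=> H.
    by move=> w /hback[v uv <-] /IH/(H v uv)/IH.
  by move=> v /hacc/H{}H /IH/H/IH.
- by rewrite !IH.
- by rewrite !IH.
- split=> H.
    by move=> w n /hback[v uv <-]; apply/IH/H.
  by move=> v n /hacc uv; apply/IH/H.
- by split=> -[n /IH H]; exists n.
Qed.

Lemma forces_order_isomorphism (L : signature) (V W : frame)
    (I : V -> set nat) (J : W -> set nat) (tau : V -> W) :
  order_isomorphism tau -> (forall u, I u = J (tau u)) ->
  forall u (A : formula L), forces I u A <-> forces J (tau u) A.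
Proof.
move=> [[g _ gK] tau_acc]; apply: forces_bounded_morphism => [u v|u w].
  by rewrite -tau_acc.
by rewrite -{1}(gK w) -tau_acc; exists (g w).
Qed.

Lemma unit_order : order unit (fun _ _ => True).
Proof. by split=> [x|x y z|[] []]. Qed.

Definition one_world_frame : frame := Frame unit_order.

Lemma one_world_persistent (L : signature) (G : goedel_numbering L)
    (X : set nat) (X_SENT : X `<=` SENT G) :
  persistent G (fun _ : one_world_frame => X).
Proof. by split=> // u v _ x. Qed.

Lemma forces_ff_svi (L : signature) (G : goedel_numbering L)
    (M N : structure G) (A : formula L) :
  (forall v : M, forces_ff G (@interp L G M) v A) ->
  forall w : N, forces_svi M w A.
Proof.
move=> ffA w N' f tau tau_iso _ MN'.
have [[g tauK gK] tau_acc] := tau_iso.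
(* The interpretation of [N'] is moved to the frame of [M] along the inverse [g] of [tau]. *)
apply/(@forces_order_isomorphism L _ _ _ (@interp L G N' \o g) tau tau_iso).
  by move=> u /=; rewrite tauK.
have [N'_SENT N'_mono] := @interp_persistent L G N'.
apply: ffA => [|v /=]; last by rewrite -{1}(gK v); apply: MN'.
split=> [v|u v uv]; first exact: N'_SENT.
by apply: N'_mono; rewrite tau_acc !gK.
Qed.

Lemma forces_svi_ff (L : signature) (G : goedel_numbering L) (M : structure G)
    (X : set nat) (A : formula L) :
  X `<=` SENT G -> (forall v : M, X `<=` interp v) ->
  (forall (N : structure G) (w : N), interp w = X -> forces_svi M w A) ->
  forall v : M, forces_ff G (@interp L G M) v A.
Proof.
move=> X_SENT XM sviA v I' I'_pers MI'.
pose N := Structure (@one_world_persistent L G X X_SENT).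
have sviN := sviA N tt erefl.
(* [I'] lives on the frame of [M], so [id] serves as [tau]; the single world goes to [v]. *)
apply: (sviN (Structure I'_pers) (fun=> v) id) => //.
- by split=> //; exists id.
- split=> [[] [] //|u u'|u x Xx /=].
    by split=> // _; apply: (ord_refl _ _ (@acc_order M)).
  exact/MI'/XM.
Qed.

(** The factor [SENT G] makes the intersection over an empty set of worlds equal [SENT G] instead of
    all of [nat]. *)
Theorem theorem2 (L : signature) (G : goedel_numbering L) (M : structure G)
    (M_fixed : J_ff G (@interp L G M) = @interp L G M) :
  SENT G `&` \bigcap_(w in [set: M]) interp w =
  J_svi M (SENT G `&` \bigcap_(w in [set: M]) interp w).
Proof.
have interpE (v : M) A :
    sentence A -> interp v (G A) <-> forces_ff G (@interp L G M) v A.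
  move=> sA; rewrite -{1}M_fixed; split; last by exists A.
  by move=> [B [_ ffB] /code_inj <-].
apply/seteqP; split=> [_ [[A sA <-] MA]|_ [A [sA sviA] <-]].
  exists A => //; split=> // N w _; apply: forces_ff_svi => v.
  by apply/interpE => //; apply: MA.
split; first by exists A.
move=> v _; apply/interpE => //; apply: forces_svi_ff sviA v => [x []//|v x [_]].
exact.
Qed.
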